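(* There is an absolute constant $c_0>0$ such that the following holds. Let $d,n$ be positive integers and $\alpha,\delta\in[0,1]$. Every $2$-query $(\alpha,\delta)$-approximate LDC of size $n$ and dimension $d$ satisfies $n \geq 2^{c_0\,\alpha\delta\sqrt{d}}$ (i.e. $n\ge 2^{\Omega(\alpha\delta\sqrt d)}$).
   Context: For $\vec u\in\mathbb R^d$ nonzero, $\mathsf{weight}_i(\vec u)=|\langle \vec u,\vec e_i\rangle|/\|\vec u\|_2$, where $\vec e_i$ is the $i$-th standard basis vector. A $q$-matching in $[n]$ is a set of pairwise disjoint $q$-element subsets of $[n]=\{1,\dots,n\}$. A $q$-query $(\alpha,\delta)$-approximate LDC of size $n$ and dimension $d$ is a pair $(V,M)$ where $V=\{\vec v_1,\dots,\vec v_n\}$ is a multiset of vectors in $\mathbb R^d$ and $M=(M_1,\dots,M_d)$, each $M_i$ a $q$-matching in $[n]$, such that for every $i\in[d]$ and every $\{j_1,\dots,j_q\}\in M_i$ there is $\vec u\in\mathrm{span}\{\vec v_{j_1},\dots,\vec v_{j_q}\}$ with $\mathsf{weight}_i(\vec u)\ge\alpha$, and $|M_1|+\cdots+|M_d|\ge \delta d n$. *)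

(* Defs.v *)
From HB Require Import structures.
From mathcomp Require Import all_boot all_order all_algebra.
From mathcomp Require Import all_classical all_reals all_analysis.

Set Implicit Arguments.
Unset Strict Implicit.
Unset Printing Implicit Defensive.

Import Order.TTheory GRing.Theory Num.Theory.
Local Open Scope ring_scope.

Definition dotv (R : realType) (d : nat) (u v : 'rV[R]_d) : R :=
  \sum_(k < d) u 0 k * v 0 k.

(* The library norm on ['rV[R]_d] is the sup norm, hence this definition. *)
Definition norm2 (R : realType) (d : nat) (u : 'rV[R]_d) : R :=
  Num.sqrt (dotv u u).

(* Meaningful for [u != 0] only. *)
Definition weight (R : realType) (d : nat) (i : 'I_d) (u : 'rV[R]_d) : R :=
  `|dotv u (delta_mx 0 i)| / norm2 u.

Definition qmatching (q n : nat) (M : {set {set 'I_n}}) : Prop :=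
  finset.trivIset M /\ (forall S : {set 'I_n}, S \in M -> #|S| = q).

(* The multiset of vectors is the family [V] indexed by ['I_n].  The witness
   [u] must be nonzero, since weights are defined for nonzero vectors only. *)
Definition approx_LDC (R : realType) (q : nat) (alpha delta : R) (n d : nat)
    (V : 'I_n -> 'rV[R]_d) (M : 'I_d -> {set {set 'I_n}}) : Prop :=
  [/\ forall i : 'I_d, qmatching q (M i),
      forall (i : 'I_d) (S : {set 'I_n}), S \in M i ->
        exists u : 'rV[R]_d,
          [/\ u \in <<[seq V j | j in S]>>%VS, u != 0 & alpha <= weight i u]
    & delta * d%:R * n%:R <= \sum_(i < d) #|M i|%:R ].

(* Main.v *)
Require Import Defs.
From HB Require Import structures.
From mathcomp Require Import all_boot all_order all_algebra.
From mathcomp Require Import all_classical all_reals all_analysis.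
From mathcomp Require Import ring lra.

(** Normalise the vectors and replace each by the two points [w] and [-w]. For
    unit vectors the span of a pair is spanned orthogonally by their sum and
    difference, so a decoding pair for [i] gives differences of points whose
    [i]-th coordinate has at least the fraction [alpha / sqrt d] of the l1-norm.
    Now split the point set recursively by axis-parallel cuts. By averaging, one
    can choose each cut so that the total fraction carried by the separated
    edges is at most the number of separated edges in the direction of the cut;
    since these form a matching up to the doubling, that number is at most a
    constant times the size of the smaller part. Summing over the recursion, the
    total fraction is O(n log n), while it is at least
    [(alpha / sqrt d) * delta * d * n]. *)

Import Order.TTheory GRing.Theory Num.Theory.
Local Open Scope ring_scope.

(** Clamping the entries to the interval from [y] to [z] turns each selected gap into a full
    increment and every other gap into zero, so the sum telescopes. *)
Lemma sum_gaps_between (R : realDomainType) (s : seq R) (y z : R) :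
  sorted <=%O s -> y \in s -> z \in s -> y <= z ->
  \sum_(0 <= k < (size s).-1) (s`_k.+1 - s`_k) * (y <= s`_k < z)%R%:R = z - y.
Proof.
move=> ss ys zs yz.
have s0 : (0 < size s)%N by case: s ys {ss zs}.
have nth_le j k : (j <= k)%N -> (k < size s)%N -> s`_j <= s`_k.
  move=> jk ks; apply: (sorted_leq_nth le_trans le_refl) => //.
  by rewrite inE (leq_ltn_trans jk).
have next w k : w \in s -> s`_k < w -> (k.+1 < size s)%N -> s`_k.+1 <= w.
  move=> /(nthP 0) [q qs <-] kq ks; apply: (nth_le) => //.
  by rewrite ltnNge; apply/negP => /nth_le qk; move: kq; rewrite ltNge qk ?(ltnW ks).
pose clip t := Num.min (Num.max t y) z.
transitivity (\sum_(0 <= k < (size s).-1) (clip s`_k.+1 - clip s`_k)).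
  apply: eq_big_nat => k /= kn.
  have ks : (k.+1 < size s)%N by rewrite -ltn_predRL.
  have kk : s`_k <= s`_k.+1 by apply: nth_le.
  rewrite /clip; case: (leP y s`_k) => [yk|ky] /=; last first.
    rewrite mulr0 (max_idPr _) ?(next _ _ ys) //.
    by rewrite subrr.
  rewrite (max_idPl _) ?(le_trans yk) //.
  case: (ltP s`_k z) => [kz|zk].
    by rewrite mulr1 (min_idPl _) // next.
  by rewrite mulr0 (min_idPr _) ?(le_trans zk) // subrr.
rewrite telescope_sumr // /clip.
have -> : Num.max s`_0 y = y.
  apply: max_r; have /(nthP 0) [q qs <-] := ys; exact: nth_le.
have zl : z <= s`_(size s).-1.
  have /(nthP 0) [q qs <-] := zs; apply: nth_le; rewrite ?prednK //.
  by rewrite -ltnS prednK.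
by rewrite (min_l yz) min_r // le_max zl.
Qed.

(** * Axis-parallel cuts of a finite family of points *)

Section AxisCuts.
Context {R : realType} {d : nat}.
Implicit Types (v : 'rV[R]_d) (i j : 'I_d).

Definition norm1 v : R := \sum_j `|v 0 j|.

(* Equal to [0] at [v = 0]. *)
Definition share i v : R := `|v 0 i| / norm1 v.

Lemma norm1_ge0 v : 0 <= norm1 v.
Proof. exact: sumr_ge0. Qed.

Lemma share_ge0 i v : 0 <= share i v.
Proof. by rewrite divr_ge0 ?norm1_ge0. Qed.

Lemma shareN i v : share i (- v) = share i v.
Proof.
rewrite /share /norm1 mxE normrN; congr (_ / _).
by apply: eq_bigr => j _; rewrite mxE normrN.
Qed.

Lemma share_norm1 i v : share i v * norm1 v = `|v 0 i|.
Proof.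
have [v0|v0] := eqVneq (norm1 v) 0; last by rewrite divfK.
rewrite v0 mulr0; have /eqP := v0.
by rewrite psumr_eq0 // => /allP /(_ i); rewrite mem_index_enum => /(_ isT) /eqP.
Qed.

Section Family.
Context {T : finType} (X : T -> 'rV[R]_d) (A : 'I_d -> rel T).

Definition sepcut j (t : R) (a b : T) : bool :=
  (X a 0 j <= t) != (X b 0 j <= t).

(** The sum runs over ordered pairs, so a symmetric [A i] counts each edge in both orientations. *)
Definition edge_share (P : rel T) : R :=
  \sum_i \sum_a \sum_(b | A i a b && P a b) share i (X a - X b).

(* Average over all axis-parallel cuts, weighted by length: among the cuts that
   separate a direction-[i] edge, the fraction [share i] has direction [i], so
   both sides of the final inequality have the same average. *)
Lemma exists_good_cut (S : {set T}) :
  (exists j, exists a, exists b, [/\ a \in S, b \in S & X a 0 j < X b 0 j]) ->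
  exists j, exists t, [/\ exists2 a, a \in S & X a 0 j <= t,
    exists2 b, b \in S & t < X b 0 j &
    edge_share (fun a b => [&& a \in S, b \in S & sepcut j t a b]) <=
    \sum_a \sum_(b | A j a b && [&& a \in S, b \in S & sepcut j t a b]) 1].
Proof.
move=> [j0 [a0 [b0 [a0S b0S ab0]]]].
pose s j := sort <=%O [seq X a 0 j | a in S].
have ss j : sorted <=%O (s j) by apply: sort_sorted; exact: le_total.
have sS j a : a \in S -> X a 0 j \in s j.
  by move=> aS; rewrite mem_sort; apply/fintype.imageP; exists a.
have sSn j k : (k < size (s j))%N -> exists2 a, a \in S & (s j)`_k = X a 0 j.
  move=> ks; have := mem_nth 0 ks; rewrite mem_sort => /fintype.imageP [a aS e].
  by exists a.
(* All thresholds from one entry of [s j] up to the next separate the same pairs of [S], so the gap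
   [w j k] serves as their length. It vanishes at repeated coordinates. *)
pose w j k := (s j)`_k.+1 - (s j)`_k.
have w_ge0 j k : (k < (size (s j)).-1)%N -> 0 <= w j k.
  rewrite ltn_predRL => ks; rewrite subr_ge0.
  by apply: (sorted_leq_nth le_trans le_refl) => //; rewrite inE ltnW.
have layer j a b : a \in S -> b \in S ->
    \sum_(0 <= k < (size (s j)).-1) w j k * (sepcut j (s j)`_k a b)%:R
    = `|(X a - X b) 0 j|.
  move=> aS bS; rewrite !mxE.
  wlog ab : a b aS bS / X a 0 j <= X b 0 j.
    move=> H; have [|/ltW ba] := leP (X a 0 j) (X b 0 j); first exact: H.
    rewrite distrC -H //; apply: eq_bigr => k _; congr (_ * _%:R).
    by rewrite /sepcut eq_sym.
  rewrite distrC ger0_norm ?subr_ge0 // -(@sum_gaps_between _ (s j)) ?sS //.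
  apply: eq_bigr => k _; congr (_ * (nat_of_bool _)%:R); rewrite /sepcut.
  case: (leP (X a 0 j)) => /= h; last by rewrite leNgt (lt_le_trans h).
  by rewrite ltNge; case: (_ <= _).
(* [F j t] is the left side minus the right side of the desired inequality; a good cut is one where
   it is nonpositive. *)
pose F j t := \sum_i \sum_a \sum_(b | A i a b && [&& a \in S & b \in S])
   (share i (X a - X b) - (i == j)%:R) * (sepcut j t a b)%:R.
have FE j t : F j t =
    edge_share (fun a b => [&& a \in S, b \in S & sepcut j t a b]) -
    \sum_a \sum_(b | A j a b && [&& a \in S, b \in S & sepcut j t a b]) 1.
  have -> : \sum_a \sum_(b | A j a b && [&& a \in S, b \in S & sepcut j t a b]) 1
     = \sum_i \sum_a \sum_(b | A i a b && [&& a \in S, b \in S & sepcut j t a b])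
       ((i == j)%:R : R).
    rewrite (bigD1 j) //= eqxx [X in _ + X]big1 ?addr0 // => i /negbTE ->.
    by rewrite big1 // => a _; rewrite big1.
  rewrite /edge_share -sumrB; apply: eq_bigr => i _.
  rewrite -sumrB; apply: eq_bigr => a _; rewrite -sumrB.
  rewrite [RHS]big_mkcond [LHS]big_mkcond; apply: eq_bigr => b _.
  case: (A i a b); case: (a \in S); case: (b \in S); case: (sepcut _ _ _ _) => //=;
    by rewrite ?mulr1 ?mulr0.
(* After exchanging the sums, an edge of direction [i] contributes its share times its l1-length,
   minus its [i]-th coordinate length, which is zero. *)
have F0 : \sum_j \sum_(0 <= k < (size (s j)).-1) w j k * F j (s j)`_k = 0.
  transitivity (\sum_i \sum_a \sum_(b | A i a b && [&& a \in S & b \in S])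
     \sum_j (share i (X a - X b) - (i == j)%:R) *
       \sum_(0 <= k < (size (s j)).-1) w j k * (sepcut j (s j)`_k a b)%:R).
    under eq_bigr => j _ do
      (under eq_bigr => k _ do (rewrite mulr_sumr;
         under eq_bigr => i _ do (rewrite mulr_sumr;
           under eq_bigr => a _ do rewrite mulr_sumr)); rewrite exchange_big).
    rewrite exchange_big; apply: eq_bigr => i _ /=.
    under eq_bigr => j _ do rewrite exchange_big /=.
    rewrite exchange_big; apply: eq_bigr => a _ /=.
    under eq_bigr => j _ do rewrite exchange_big /=.
    rewrite exchange_big; apply: eq_bigr => b _ /=.
    apply: eq_bigr => j _; rewrite mulr_sumr; apply: eq_bigr => k _; ring.
  apply: big1 => i _; apply: big1 => a _; apply: big1 => b /and3P [_ aS bS].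
  under eq_bigr => j _ do rewrite (layer _ _ _ aS bS) mulrBl.
  rewrite sumrB -mulr_sumr share_norm1 (bigD1 i) //= eqxx mul1r big1 ?addr0 ?subrr //.
  by move=> j; rewrite eq_sym => /negbTE ->; rewrite mul0r.
apply: contrapT => nogood.
(* A positive gap has points of [S] on both sides, so only the inequality can fail there. With [F0]
   this forces all gaps in direction [j0] to vanish, although [a0] and [b0] differ there. *)
have Fpos j k : (k < (size (s j)).-1)%N -> 0 < w j k -> 0 < F j (s j)`_k.
  rewrite ltn_predRL subr_gt0 => ks wk; rewrite ltNge; apply/negP => Fle.
  apply: nogood; exists j, (s j)`_k; split; last by rewrite -subr_le0 -FE.
    by have [a aS ->] := sSn j k (ltnW ks); exists a.
  by have [b bS e] := sSn j k.+1 ks; exists b; rewrite // -e.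
have term_ge0 j k : (k < (size (s j)).-1)%N -> 0 <= w j k * F j (s j)`_k.
  move=> ks; have := w_ge0 j k ks; rewrite le_eqVlt => /predU1P [<-|wk].
    by rewrite mul0r.
  by rewrite mulr_ge0 ?(ltW wk) // ltW // Fpos.
have row_ge0 j : 0 <= \sum_(0 <= k < (size (s j)).-1) w j k * F j (s j)`_k.
  by rewrite big_nat; apply: sumr_ge0 => k /= ks; exact: term_ge0.
have w0 k : (k < (size (s j0)).-1)%N -> w j0 k = 0.
  move=> ks; move: F0 => /eqP; rewrite psumr_eq0 // => /allP /(_ j0).
  rewrite mem_index_enum => /(_ isT) /=.
  rewrite big_mkord psumr_eq0 => [|l _]; last exact: term_ge0.
  move=> /allP /(_ (Ordinal ks)); rewrite mem_index_enum => /(_ isT) /=.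
  rewrite mulf_eq0 => /orP [/eqP //|/eqP F0].
  apply/eqP; rewrite eq_le w_ge0 // andbT leNgt; apply/negP => /(Fpos _ _ ks).
  by rewrite F0 ltxx.
have := layer j0 a0 b0 a0S b0S; rewrite big_nat big1 => [|k /= ks].
  move/esym/eqP; rewrite normr_eq0 !mxE subr_eq0 => /eqP e.
  by move: ab0; rewrite e ltxx.
by rewrite w0 // mul0r.
Qed.

Definition inside (S : {set T}) : rel T := fun a b => (a \in S) && (b \in S).

Lemma edge_share_cut (S S1 S2 : {set T}) j t :
    S1 = [set a in S | X a 0 j <= t] -> S2 = [set a in S | ~~ (X a 0 j <= t)] ->
  edge_share (inside S) = edge_share (inside S1) + edge_share (inside S2) +
    edge_share (fun a b => [&& a \in S, b \in S & sepcut j t a b]).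
Proof.
move=> -> ->; rewrite /edge_share -!big_split; apply: eq_bigr => i _ /=.
rewrite -!big_split; apply: eq_bigr => a _ /=.
rewrite (big_mkcond (fun b => A i a b && inside S a b)).
rewrite (big_mkcond (fun b => A i a b && inside [set a in S | X a 0 j <= t] a b)).
rewrite (big_mkcond (fun b => A i a b && inside [set a in S | ~~ (X a 0 j <= t)] a b)).
rewrite (big_mkcond (fun b => A i a b && [&& a \in S, b \in S & sepcut j t a b])).
rewrite -!big_split; apply: eq_bigr => b _ /=; rewrite /inside /sepcut !inE.
case: (A i a b); case: (a \in S); case: (b \in S);
  case: (X a 0 j <= t); case: (X b 0 j <= t) => //=;
  by rewrite ?addr0 ?add0r.
Qed.

(** The factor 2 accounts for the two orientations, equally many by symmetry; the degree bound
    applies from either side of the cut, whence the minimum. *)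
Lemma sum_crossing_le (k : nat) (S S1 S2 : {set T}) j t :
    S1 = [set a in S | X a 0 j <= t] -> S2 = [set a in S | ~~ (X a 0 j <= t)] ->
    symmetric (A j) -> (forall a, (#|[set b | A j a b]| <= k)%N) ->
  \sum_a \sum_(b | A j a b && [&& a \in S, b \in S & sepcut j t a b]) 1 <=
    2 * k%:R * Num.min #|S1|%:R #|S2|%:R :> R.
Proof.
move=> e1 e2 symA degA.
pose N (U W : {set T}) : R := \sum_(a in U) \sum_(b in W | A j a b) 1.
have NC U W : N U W = N W U.
  rewrite /N (exchange_big_dep (mem W)) /= => [|a b _ /andP [] //].
  by apply: eq_bigr => b bW; apply: eq_bigl => a; rewrite bW symA.
have N_le U W : N U W <= k%:R * #|U|%:R.
  rewrite mulrC mulr_natl -sumr_const; apply: ler_sum => a _.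
  rewrite sumr_const ler_nat; apply: leq_trans (degA a).
  by apply: subset_leq_card; apply/fintype.subsetP => b; rewrite !inE => /andP [].
have -> : \sum_a \sum_(b | A j a b && [&& a \in S, b \in S & sepcut j t a b]) 1
    = N S1 S2 + N S2 S1.
  rewrite /N e1 e2 (big_mkcond (fun a => a \in finset _)).
  rewrite (big_mkcond (fun a => a \in [set a in S | ~~ (X a 0 j <= t)])).
  rewrite -big_split; apply: eq_bigr => a _ /=; rewrite !inE.
  case: (a \in S) => /=; last by rewrite big_pred0 ?addr0 // => b; rewrite andbF.
  rewrite /sepcut; case: (X a 0 j <= t) => /=; rewrite ?addr0 ?add0r;
    apply: eq_bigl => b; rewrite !inE;
    by case: (b \in S); case: (A j a b); case: (X b 0 j <= t).
have Nmin : N S1 S2 <= k%:R * Num.min #|S1|%:R #|S2|%:R.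
  by rewrite minr_pMr ?ler0n // le_min N_le NC N_le.
by rewrite [N S2 S1]NC -mulrA; lra.
Qed.

(** If [x <= y], then [x + y] is at least [2 * x], which gains [ln 2] on the weight [x]; on the
    weight [y] monotonicity of [ln] suffices. *)
Lemma entropy_split (x y : R) : 0 < x -> 0 < y ->
  Num.min x y * ln 2 <= (x + y) * ln (x + y) - x * ln x - y * ln y.
Proof.
wlog xy : x y / x <= y.
  move=> H x0 y0; have /orP [xy|yx] := le_total x y; first exact: H.
  by rewrite minC (addrC x y) addrAC H.
move=> x0 y0; rewrite min_l //.
have h1 : ln x + ln 2 <= ln (x + y).
  by rewrite -lnM ?posrE // ler_ln ?posrE ?mulr_gt0 ?addr_gt0 //; lra.
have h2 : ln y <= ln (x + y) by rewrite ler_ln ?posrE ?addr_gt0 //; lra.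
have := ler_wpM2l (ltW x0) h1; have := ler_wpM2l (ltW y0) h2.
by rewrite mulrDr mulrDl; lra.
Qed.

(** Strong induction on the size of [S]: by [entropy_split], the drop of the potential
    [#|S| * ln #|S|] under a good cut pays for the separated edges. *)
Lemma edge_share_le (k : nat) (S : {set T}) :
    (forall j, symmetric (A j)) ->
    (forall j a, (#|[set b | A j a b]| <= k)%N) ->
  edge_share (inside S) * ln 2 <= 2 * k%:R * (#|S|%:R * ln #|S|%:R).
Proof.
move=> symA degA; have [m] := ubnP #|S|; elim: m S => // m IH S Sm.
(* If no coordinate distinguishes points of [S], all differences vanish and so do their shares. This
   covers coinciding points as well as the empty set, where [ln 0 = 0]. *)
have [nonconst|const] := pselect
  (exists j, exists a, exists b, [/\ a \in S, b \in S & X a 0 j < X b 0 j]);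
  last first.
  rewrite (_ : edge_share _ = 0) ?mul0r.
    rewrite !mulr_ge0 //; have [->|S0] := posnP #|S|; first by rewrite ln0.
    by rewrite ln_ge0 // ler1n.
  rewrite /edge_share; apply: big1 => i _; apply: big1 => a _.
  apply: big1 => b /and3P [_ aS bS]; rewrite /share !mxE.
  have [ab|ab|->] := ltgtP (X a 0 i) (X b 0 i); last by rewrite subrr normr0 mul0r.
  - by case: const; exists i, a, b.
  - by case: const; exists i, b, a.
have [j [t [[a aS at_] [b bS bt] good]]] := exists_good_cut _ nonconst.
pose S1 := [set a in S | X a 0 j <= t].
pose S2 := [set a in S | ~~ (X a 0 j <= t)].
have S1_gt0 : (0 < #|S1|)%N by apply/card_gt0P; exists a; rewrite inE aS.
have S2_gt0 : (0 < #|S2|)%N.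
  by apply/card_gt0P; exists b; rewrite inE bS -ltNge.
have cardS : (#|S| = #|S1| + #|S2|)%N.
  rewrite -(cardsID [set a | X a 0 j <= t] S); congr (_ + _)%N;
    by apply: eq_card => c; rewrite !inE // andbC.
rewrite (edge_share_cut _ _ _ _ _ (erefl S1) (erefl S2)).
have cross := le_trans good
  (sum_crossing_le k _ _ _ _ _ (erefl S1) (erefl S2) (symA j) (degA j)).
have IH1 : edge_share (inside S1) * ln 2 <= 2 * k%:R * (#|S1|%:R * ln #|S1|%:R).
  by apply: IH; rewrite -ltnS (leq_trans _ Sm) // ltnS cardS -addn1 leq_add2l.
have IH2 : edge_share (inside S2) * ln 2 <= 2 * k%:R * (#|S2|%:R * ln #|S2|%:R).
  by apply: IH; rewrite -ltnS (leq_trans _ Sm) // ltnS cardS -add1n leq_add2r.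
have ln2_ge0 : 0 <= ln (2 : R) by rewrite ln_ge0 // ler1n.
have h := entropy_split #|S1|%:R #|S2|%:R.
rewrite !ltr0n -natrD -cardS in h; have {}h := h S1_gt0 S2_gt0.
have k0 : 0 <= 2 * k%:R :> R by rewrite mulr_ge0.
have {}h := ler_wpM2l k0 h.
have {}cross := ler_wpM2r ln2_ge0 cross.
rewrite !mulrDl; move: h; rewrite !mulrBr mulrA; lra.
Qed.

End Family.
End AxisCuts.

(** * Euclidean weights against l1 shares *)

Section UnitVectors.
Context {R : realType} {d : nat}.
Implicit Types (u v w s t : 'rV[R]_d) (i : 'I_d).

Lemma dotvC u v : dotv u v = dotv v u.
Proof. by apply: eq_bigr => k _; rewrite mulrC. Qed.

Lemma dotv_linear_l (x y : R) u v w :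
  dotv (x *: u + y *: v) w = x * dotv u w + y * dotv v w.
Proof.
rewrite /dotv !mulr_sumr -big_split; apply: eq_bigr => k _ /=.
by rewrite !mxE; ring.
Qed.

Lemma dotv_ge0 u : 0 <= dotv u u.
Proof. by apply: sumr_ge0 => k _; rewrite -expr2 sqr_ge0. Qed.

Lemma dotv_eq0 u : dotv u u = 0 -> u = 0.
Proof.
move=> /eqP; rewrite psumr_eq0 => [/allP h|k _]; last by rewrite -expr2 sqr_ge0.
apply/rowP => k; have := h k; rewrite mem_index_enum => /(_ isT) /=.
by rewrite -expr2 sqrf_eq0 mxE => /eqP.
Qed.

Lemma dotv_delta u i : dotv u (delta_mx 0 i) = u 0 i.
Proof.
rewrite /dotv (bigD1 i) //= mxE !eqxx mulr1 big1 ?addr0 // => k /negbTE ki.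
by rewrite mxE ki andbF mulr0.
Qed.

(** Cauchy-Schwarz, obtained by expanding the sum of squared deviations of the absolute coordinates
    from their mean [l]. *)
Lemma norm1_le_norm2 v : norm1 v <= Num.sqrt d%:R * norm2 v.
Proof.
rewrite -sqrtrM ?ler0n // -[norm1 v]ger0_norm ?norm1_ge0 // -sqrtr_sqr ler_wsqrtr //.
have [d0|d0] := posnP d.
  rewrite /norm1 big1 ?expr0n ?mulr_ge0 ?dotv_ge0 // => k _.
  by have := ltn_ord k; rewrite [ltnRHS]d0.
have dR : 0 < d%:R :> R by rewrite ltr0n.
pose l := norm1 v / d%:R.
have : 0 <= \sum_(k < d) (`|v 0 k| - l) ^+ 2 by apply: sumr_ge0 => k _; exact: sqr_ge0.
have -> : \sum_(k < d) (`|v 0 k| - l) ^+ 2 = dotv v v - norm1 v ^+ 2 / d%:R.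
  transitivity (\sum_(k < d) (v 0 k * v 0 k - 2 * l * `|v 0 k| + l ^+ 2)).
    apply: eq_bigr => k _; rewrite -expr2 -[in RHS]real_normK ?num_real //; ring.
  rewrite big_split sumrB -mulr_sumr /= sumr_const card_ord -mulr_natr /l.
  rewrite -/(norm1 v) -/(dotv v v); field.
  by rewrite gt_eqF.
by rewrite subr_ge0 ler_pdivrMr // mulrC.
Qed.

(* For unit vectors the sum and the difference are orthogonal, so neither
   component of [u] is longer than [u], however nearly parallel they are. *)
Lemma weight_le_share (alpha x y : R) w1 w2 u i :
    dotv w1 w1 = 1 -> dotv w2 w2 = 1 -> u = x *: w1 + y *: w2 -> u != 0 ->
    alpha <= weight i u ->
  alpha <= Num.sqrt d%:R * (share i (w1 + w2) + share i (w1 - w2)).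
Proof.
move=> w11 w22 uE u0 au.
set s := w1 + w2; set t := w1 - w2.
pose p := (x + y) / 2; pose q := (x - y) / 2.
have uE' : u = p *: s + q *: t.
  by rewrite uE; apply/rowP => k; rewrite !mxE /p /q; field.
have st : dotv s t = 0.
  have sE : s = 1 *: w1 + 1 *: w2 by rewrite !scale1r.
  have tE : t = 1 *: w1 + (- 1) *: w2 by rewrite scale1r scaleN1r.
  rewrite sE dotv_linear_l (dotvC w1) (dotvC w2) tE !dotv_linear_l w11 w22 (dotvC w2 w1).
  ring.
have uu : dotv u u = p ^+ 2 * dotv s s + q ^+ 2 * dotv t t.
  rewrite {1}uE' dotv_linear_l (dotvC s) (dotvC t) uE' !dotv_linear_l (dotvC t s) st.
  ring.
have nu : 0 < norm2 u.
  rewrite sqrtr_gt0 lt_neqAle dotv_ge0 andbT eq_sym.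
  by apply: contra u0 => /eqP /dotv_eq0 ->.
(* The bound also holds for [v = 0], which occurs when [w1] and [w2] are equal or opposite. *)
have comp (c : R) v : c ^+ 2 * dotv v v <= dotv u u ->
    `|c * v 0 i| <= share i v * Num.sqrt d%:R * norm2 u.
  move=> cv.
  have cn : `|c| * norm2 v <= norm2 u.
    by rewrite -sqrtr_sqr -sqrtrM ?sqr_ge0 // ler_wsqrtr.
  rewrite normrM -share_norm1 mulrCA -mulrA ler_wpM2l ?share_ge0 //.
  apply: le_trans (ler_wpM2l (normr_ge0 c) (norm1_le_norm2 v)) _.
  by rewrite mulrCA ler_wpM2l ?sqrtr_ge0.
have := comp p s; have := comp q t; rewrite uu.
rewrite lerDr mulr_ge0 ?sqr_ge0 ?dotv_ge0 // => /(_ isT) qt.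
rewrite lerDl mulr_ge0 ?sqr_ge0 ?dotv_ge0 // => /(_ isT) ps.
rewrite -(ler_pM2r nu); move: au; rewrite /weight dotv_delta ler_pdivlMr //.
move=> /le_trans; apply.
have -> : u 0 i = p * s 0 i + q * t 0 i.
  by rewrite {1}uE' mxE [X in X + _]mxE [X in _ + X]mxE.
apply: le_trans (ler_normD _ _) _; apply: le_trans (lerD ps qt) _.
by rewrite mulrDr !mulrDl [share i s * _]mulrC [share i t * _]mulrC.
Qed.

(** A zero vector is the zero multiple of any unit vector; [i] supplies one. *)
Lemma exists_unit_multiple v i :
  exists w, dotv w w = 1 /\ exists c : R, v = c *: w.
Proof.
have [->|v0] := eqVneq v 0.
  exists (delta_mx 0 i); split; first by rewrite dotv_delta mxE !eqxx.
  by exists 0; rewrite scale0r.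
have nv : norm2 v != 0.
  rewrite sqrtr_eq0 -ltNge lt_neqAle dotv_ge0 andbT eq_sym.
  by apply: contra v0 => /eqP /dotv_eq0 ->.
exists ((norm2 v)^-1 *: v); split; last by exists (norm2 v); rewrite scalerA divff ?scale1r.
rewrite -[_ *: v]addr0 -(scale0r 0) dotv_linear_l dotvC dotv_linear_l.
rewrite !mul0r !addr0 -[dotv v v]sqr_sqrtr ?dotv_ge0 // -/(norm2 v).
by field.
Qed.

Lemma memv_span_set2 n (V : 'I_n -> 'rV[R]_d) (a b : 'I_n) u :
  u \in <<[seq V j | j in [set a; b]]>>%VS ->
  exists x y : R, u = x *: V a + y *: V b.
Proof.
have sub : (<<[seq V j | j in [set a; b]]>> <= <[V a]> + <[V b]>)%VS.
  apply/span_subvP => _ /fintype.imageP [j + ->].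
  rewrite !inE => /orP [] /eqP ->.
    exact: subvP (addvSl _ _) _ (memv_line _).
  exact: subvP (addvSr _ _) _ (memv_line _).
move=> /(subvP sub) /memv_addP [_ /vlineP [x ->] [_ /vlineP [y ->] ->]].
by exists x, y.
Qed.

End UnitVectors.

(** * Degrees and edge counts in a 2-matching *)

Section Matchings.
Context {n : nat} (M : {set {set 'I_n}}).
Hypothesis matchM : qmatching 2 M.

Lemma matching_neighbour_uniq (a b b' : 'I_n) :
  [set a; b] \in M -> [set a; b'] \in M -> b = b'.
Proof.
have [triv card2] := matchM; move=> ab ab'.
have e : [set a; b] = [set a; b'].
  apply/eqP; apply: contraT => ne.
  have := finset.trivIsetP triv _ _ ab ab' ne.
  by move=> /pred0P /(_ a); rewrite /= !inE !eqxx.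
have := card2 _ ab; rewrite cards2; case: eqVneq => // nab _.
have : b \in [set a; b'] by rewrite -e !inE eqxx orbT.
by rewrite !inE eq_sym (negbTE nab) => /eqP.
Qed.

Lemma card_matching_le :
  (#|M| <= #|[set p : 'I_n * 'I_n | [set p.1; p.2] \in M]|)%N.
Proof.
have [_ card2] := matchM.
apply: leq_trans (leq_imset_card (fun p => [set p.1; p.2]) _).
apply: subset_leq_card; apply/fintype.subsetP => S SM.
have /eqP/cards2P [a [b [_ SE]]] := card2 _ SM.
by apply/imsetP; exists (a, b); rewrite ?inE /= -SE.
Qed.

(** The unique partner of a point occurs in two signed copies. *)
Lemma card_lifted_neighbours (p : bool * 'I_n) :
  (#|[set q : bool * 'I_n | [set p.2; q.2] \in M]| <= 2)%N.
Proof.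
have [->|[q0]] := set_0Vmem [set q : bool * 'I_n | [set p.2; q.2] \in M].
  by rewrite cards0.
rewrite inE => q0M.
apply: (@leq_trans #|finset.setX [set: bool] [set q0.2]|); last first.
  by rewrite cardsX cardsT card_bool cards1.
apply: subset_leq_card; apply/fintype.subsetP => -[c b]; rewrite !inE /= => bM.
by rewrite (matching_neighbour_uniq _ _ _ bM q0M).
Qed.

End Matchings.

(** * The bound for the doubled family of unit vectors *)

Theorem theorem1 (R : realType) :
  exists c0 : R, 0 < c0 /\
    forall (d n : nat) (alpha delta : R),
      (0 < d)%N -> (0 < n)%N ->
      0 <= alpha <= 1 -> 0 <= delta <= 1 ->
      forall (V : 'I_n -> 'rV[R]_d) (M : 'I_d -> {set {set 'I_n}}),
        approx_LDC 2 alpha delta V M ->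
        2 `^ (c0 * alpha * delta * Num.sqrt d%:R) <= n%:R.
Proof.
(* With degree 2 and [2 * n] points the upper bound is [8 * n * ln (2 * n)], at most
   [16 * n * ln n]; the lower bound carries a factor 2, leaving 8. *)
exists (1 / 8); split; first by rewrite divr_gt0.
move=> d n alpha delta d_gt0 n_gt0 /andP [alpha0 _] /andP [delta0 _] V M.
move=> [matchM decode many].
have dR : 0 < d%:R :> R by rewrite ltr0n.
have nR : 0 < n%:R :> R by rewrite ltr0n.
(* For [n = 1] there are no pairs, so [delta = 0]. The later estimate [ln (2 * n) <= 2 * ln n]
   requires [n >= 2]. *)
have [n1|n_gt1] := leqP n 1.
  have M0 i : #|M i| = 0.
    apply/eqP; rewrite cards_eq0; apply/eqP/setP => S; rewrite inE.
    apply/negP => /((matchM i).2 S) cS.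
    by have := max_card (mem S); rewrite cS card_ord leqNgt ltnS n1.
  move: many; rewrite big1 => [|i _]; last by rewrite M0.
  rewrite -mulrA => many.
  have -> : delta = 0.
    apply/eqP; rewrite eq_le delta0 andbT.
    by rewrite -(pmulr_lle0 _ (mulr_gt0 dR nR)).
  by rewrite mulr0 mul0r powRr0 ler1n.
have [w wP] := choice (fun a => exists_unit_multiple (V a) (Ordinal d_gt0)).
(* With both signs present, sums of unit vectors also become differences of points. *)
pose X (p : bool * 'I_n) : 'rV[R]_d := (-1) ^+ p.1 *: w p.2.
pose A i (p q : bool * 'I_n) := [set p.2; q.2] \in M i.
have symA i : symmetric (A i) by move=> p q; rewrite /A finset.setUC.
have up := @edge_share_le _ _ _ X A 2 [set: bool * 'I_n] symA
  (fun i => card_lifted_neighbours _ (matchM i)).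
have low : 2 * alpha * (delta * d%:R * n%:R) <=
    Num.sqrt d%:R * edge_share X A (inside [set: bool * 'I_n]).
  apply: (@le_trans _ _ (2 * alpha * \sum_(i < d) #|M i|%:R)).
    by rewrite ler_wpM2l // mulr_ge0.
  rewrite !mulr_sumr; apply: ler_sum => i _.
  (* The four lifts of an ordered pair give the sum and the difference of its unit vectors, each
     twice up to sign. *)
  have -> : \sum_p \sum_(q | A i p q && inside [set: bool * 'I_n] p q)
      share i (X p - X q) =
    \sum_(p : 'I_n * 'I_n | [set p.1; p.2] \in M i)
       2 * (share i (w p.1 + w p.2) + share i (w p.1 - w p.2)).
    have inner p : \sum_(q | A i p q && inside [set: bool * 'I_n] p q)
        share i (X p - X q) =
      \sum_(b | [set p.2; b] \in M i)
        (share i (X p - X (true, b)) + share i (X p - X (false, b))).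
      rewrite big_split -(@big_bool _ _ _ (fun c => \sum_(b | [set p.2; b] \in M i)
        share i (X p - X (c, b)))) pair_big /=.
      by apply: eq_big => [q|[c b] //]; rewrite /inside !inE !andbT.
    under eq_bigr => p _ do rewrite inner.
    rewrite -(pair_bigA _ (fun c a => \sum_(b | [set a; b] \in M i)
      (share i (X (c, a) - X (true, b)) + share i (X (c, a) - X (false, b))))) /=.
    rewrite big_bool /= !pair_big_dep /= -big_split /=.
    apply: eq_bigr => -[a b] _ /=; rewrite /X /= !scaleN1r !scale1r !opprK.
    rewrite -[- w a - w b]opprD shareN [- w a + w b]addrC -[w b - w a]opprB shareN.
    ring.
  rewrite mulr_sumr.
  apply: (@le_trans _ _ (2 * alpha *
      #|[set p : 'I_n * 'I_n | [set p.1; p.2] \in M i]|%:R)).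
    by rewrite ler_wpM2l ?mulr_ge0 // ler_nat card_matching_le.
  rewrite mulr_natr -sumr_const big_mkcond [leRHS]big_mkcond.
  apply: ler_sum => -[a b] _ /=; rewrite inE /=; case: ifP => // abM.
  have [u [/memv_span_set2 [x [y uE]] u0 au]] := decode _ _ abM.
  rewrite mulrCA ler_pM2l //.
  have [wa [ca Va]] := wP a; have [wb [cb Vb]] := wP b.
  apply: (@weight_le_share _ _ alpha (x * ca) (y * cb) (w a) (w b) u) => //.
  by rewrite uE Va Vb !scalerA.
move: (edge_share X A _) up low => E up low {X A symA}.
have ln2 : 0 < ln (2 : R) by rewrite ln_gt0 // ltr1n.
have lnn : ln (2 * n%:R) <= 2 * ln n%:R :> R.
  rewrite lnM ?posrE //; have : ln (2 : R) <= ln n%:R by rewrite ler_ln ?posrE // ler_nat.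
  lra.
have key : alpha * delta * Num.sqrt d%:R * ln 2 <= 8 * ln n%:R.
  have sd : 0 < Num.sqrt d%:R :> R by rewrite sqrtr_gt0.
  have low' : 2 * (alpha * delta * Num.sqrt d%:R) * n%:R <= E.
    rewrite -(ler_pM2l sd); apply: le_trans low.
    (* Writing [d] as the square of its root lets one factor cancel, leaving the root in the
       exponent. *)
    rewrite -[in leRHS](sqr_sqrtr (ler0n R d)); by lra.
  have := le_trans (ler_wpM2r (ltW ln2) low') up.
  rewrite cardsT card_prod card_bool card_ord natrM => h.
  rewrite -(ler_pM2l nR).
  have := ler_wpM2l (ltW nR) lnn; lra.
rewrite /powR; case: eqP => [/eqP|_]; first by rewrite pnatr_eq0.
rewrite -[leRHS]lnK ?posrE // ler_expR; lra.
Qed.
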